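(* Let $(\omega,g)$ be an almost-hermitian structure on a real Lie algebra $\mathfrak g$ of dimension $2n$, with associated curvature operators $P=P(\omega,g)$ and $Q=Q(\omega,g)$. If for some $c\in\mathbb R$ and $D\in\mathrm{Der}(\mathfrak g)$ $$P+Q^{ac}=cI+D,$$ then $(\omega,g)$ is a $(p,q)$-soliton with the same $c$ and $D$, i.e. $$P=cI+\tfrac12(D-JD^tJ),\qquad Q=cI+\tfrac12(D+D^t).$$
   Context: An almost-hermitian structure on a $2n$-dimensional real vector space $\mathfrak g$ is a pair $(\omega,g)$, with $\omega$ a non-degenerate $2$-form and $g$ an inner product, such that the operator $J$ defined by $\omega=g(J\cdot,\cdot)$ satisfies $J^2=-I$. For $A\in\mathrm{End}(\mathfrak g)$: $A^{c}:=\frac12(A-JAJ)$, $A^{ac}:=\frac12(A+JAJ)$, and $A^t$ is the transpose relative to $g$. One fixes a rule assigning to every almost-hermitian structure $(\omega,g)$ on a Lie algebra $\mathfrak g$ a $2$-form $p=p(\omega,g)\in\Lambda^2\mathfrak g^*$ and a symmetric bilinear form $q=q(\omega,g)\in S^2\mathfrak g^*$, invariant under isomorphisms of almost-hermitian Lie algebras and with $p(c\omega,cg)=p(\omega,g)$, $q(c\omega,cg)=q(\omega,g)$ for $c>0$. Operators $P,Q\in\mathrm{End}(\mathfrak g)$ are defined by $p=\omega(P\cdot,\cdot)$, $q=g(Q\cdot,\cdot)$, and it is assumed that $P^c=Q^c$ for every almost-hermitian structure. $\mathrm{Der}(\mathfrak g)$ denotes the derivations of $\mathfrak g$. Definition.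 $(\omega,g)$ is a $(p,q)$-soliton (with cosmological constant $c$) if for some $c\in\mathbb R$ and $D\in\mathrm{Der}(\mathfrak g)$, $P(\omega,g)=cI+\frac12(D-JD^tJ)$ and $Q(\omega,g)=cI+\frac12(D+D^t)$. *)

(* Defs.v *)
From HB Require Import structures.
From mathcomp Require Import all_boot all_order all_algebra.
From mathcomp Require Import sesquilinear.
From mathcomp Require Import boolp classical_sets reals.

Set Implicit Arguments.
Unset Strict Implicit.
Unset Printing Implicit Defensive.

Import Order.TTheory GRing.Theory Num.Theory.

Local Open Scope ring_scope.

HB.mixin Record Vector_isLieAlgebra (R : realType) L & Vector R L := {
  bracket : {bilinear L -> L -> L};
  bracketxx : forall x : L, bracket x x = 0;
  bracket_jacobi : forall x y z : L,
    bracket x (bracket y z) + bracket y (bracket z x)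
      + bracket z (bracket x y) = 0
}.

#[short(type="lieAlgType")]
HB.structure Definition LieAlgebra (R : realType) :=
  { L of Vector_isLieAlgebra R L & Vector R L }.

Definition derivation (R : realType) (L : lieAlgType R) (D : 'End(L)) : Prop :=
  forall x y : L, D (bracket x y) = bracket (D x) y + bracket x (D y).

(* [form_op b a] is the operator [A] with [a = b(A., .)].  The default value
   [0] is never reached when [a] is bilinear and [b] is nondegenerate, and
   then [A] is unique: see [form_opP] and [form_op_unique]. *)
Definition form_op (R : realType) (V : vectType R) (b a : V -> V -> R) :
    'End(V) :=
  xget 0 [set A : 'End(V) | forall x y, a x y = b (A x) y]%classic.

Section FormOp.
Variables (R : realType) (V : vectType R) (eps : bool).
Variable (b : {hermitian V for eps & idfun}).
Hypothesis b_nondeg : nondegenerate b.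

Lemma nondegenerate_eq0 x : (forall y, b x y = 0) -> x = 0.
Proof.
move=> bx0; apply/eqP; rewrite -memv0; move/eqP: b_nondeg => <-.
by apply/mem_orthovP => y _; exact: bx0.
Qed.

Lemma form_op_unique (A B : 'End(V)) :
  (forall x y, b (A x) y = b (B x) y) -> A = B.
Proof.
move=> AB; apply/lfunP => x; apply/eqP; rewrite -subr_eq0; apply/eqP.
apply: nondegenerate_eq0 => y.
by transitivity (b (A x) y - b (B x) y); [exact: linearBl | rewrite AB subrr].
Qed.

Lemma form_opP (a : V -> V -> R) : bilinear_for *%R *%R a ->
  forall x y, a x y = b (form_op b a x) y.
Proof.
move=> [al ar].
suff: exists A : 'End(V), forall x y, a x y = b (A x) y.
  move=> exA; exact: (@xgetPex 'End(V) 0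
    [set A : 'End(V) | forall x y, a x y = b (A x) y]%classic exA).
have bl y : linear_for *%R (b^~ y) by move=> k u v; rewrite linearPl.
have br x : linear_for *%R (b x) by move=> k u v; rewrite linearPr.
have curry (f : V -> V -> R) : (forall y, linear_for *%R (f^~ y)) ->
    (forall x, linear_for *%R (f x)) ->
    exists F : 'Hom(V, 'Hom(V, R^o)), forall x y, F x y = f x y.
  move=> fl fr.
  pose lf x := GRing.isLinear.Build R V R^o *:%R (f x : V -> R^o) (fr x).
  pose Lf x : {linear V -> R^o} := HB.pack (f x : V -> R^o) (lf x).
  have cl : linear (fun x => linfun (Lf x)).
    move=> k u v; apply/lfunP => y; rewrite add_lfunE scale_lfunE.
    by rewrite (lfunE (Lf _)) (lfunE (Lf u)) (lfunE (Lf v)); exact: fl.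
  pose mC := GRing.isLinear.Build R V 'Hom(V, R^o) *:%R _ cl.
  pose C : {linear V -> 'Hom(V, R^o)} := HB.pack (fun x => linfun (Lf x)) mC.
  by exists (linfun C) => x y; rewrite lfunE; exact: (lfunE (Lf x)).
have [B BE] := curry b bl br; have [F FE] := curry a al ar.
have kB : lker B == 0%VS.
  rewrite -subv0; apply/subvP => x; rewrite memv_ker memv0 => /eqP Bx.
  by apply/eqP/nondegenerate_eq0 => y; rewrite -BE Bx lfunE.
have imB : limg B = fullv.
  apply/eqP; rewrite eqEdim subvf limg_dim_eq; last first.
    by rewrite (eqP kB) capv0.
  by rewrite !dimvf /dim /= muln1.
exists ((B^-1)%VF \o F)%VF => x y.
by rewrite comp_lfunE -BE limg_lfunVK ?FE // imB memvf.
Qed.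

End FormOp.

Record almostHermitian (R : realType) (V : vectType R) := AlmostHermitian {
  ah_omega : {skew_symmetric V};
  ah_g : {dot V for idfun};
  ah_omega_nondegenerate : nondegenerate ah_omega;
  ah_JJ : (form_op ah_g ah_omega \o form_op ah_g ah_omega)%VF = - \1%VF
}.

Section Operators.
Variables (R : realType) (V : vectType R) (h : almostHermitian V).
Implicit Type A : 'End(V).

Definition ah_J : 'End(V) := form_op (ah_g h) (ah_omega h).

Definition cpart A : 'End(V) := 2^-1 *: (A - (ah_J \o A \o ah_J)%VF).

Definition acpart A : 'End(V) := 2^-1 *: (A + (ah_J \o A \o ah_J)%VF).

Definition transpose A : 'End(V) :=
  form_op (ah_g h) (fun x y => ah_g h x (A y)).

End Operators.

Record ah_iso (R : realType) (L1 L2 : lieAlgType R)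
    (h1 : almostHermitian L1) (h2 : almostHermitian L2)
    (f : 'Hom(L1, L2)) : Prop := {
  ah_iso_bij : bijective f;
  ah_iso_bracket : forall x y, f (bracket x y) = bracket (f x) (f y);
  ah_iso_omega : forall x y, ah_omega h2 (f x) (f y) = ah_omega h1 x y;
  ah_iso_g : forall x y, ah_g h2 (f x) (f y) = ah_g h1 x y
}.

(* In the scaling axioms, [h'] is any structure whose forms are [c] times
   those of [h]. *)
Record pqRule (R : realType) := PQRule {
  pq_p : forall L : lieAlgType R, almostHermitian L -> {skew_symmetric L};
  pq_q : forall L : lieAlgType R, almostHermitian L -> {symmetric L};
  pq_p_iso : forall (L1 L2 : lieAlgType R)
      (h1 : almostHermitian L1) (h2 : almostHermitian L2) (f : 'Hom(L1, L2)),
    ah_iso h1 h2 f -> forall x y, pq_p h2 (f x) (f y) = pq_p h1 x y;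
  pq_q_iso : forall (L1 L2 : lieAlgType R)
      (h1 : almostHermitian L1) (h2 : almostHermitian L2) (f : 'Hom(L1, L2)),
    ah_iso h1 h2 f -> forall x y, pq_q h2 (f x) (f y) = pq_q h1 x y;
  pq_p_scale : forall (L : lieAlgType R) (h h' : almostHermitian L) (c : R),
    0 < c -> (forall x y, ah_omega h' x y = c * ah_omega h x y) ->
    (forall x y, ah_g h' x y = c * ah_g h x y) ->
    forall x y, pq_p h' x y = pq_p h x y;
  pq_q_scale : forall (L : lieAlgType R) (h h' : almostHermitian L) (c : R),
    0 < c -> (forall x y, ah_omega h' x y = c * ah_omega h x y) ->
    (forall x y, ah_g h' x y = c * ah_g h x y) ->
    forall x y, pq_q h' x y = pq_q h x y;
  pq_cpart : forall (L : lieAlgType R) (h : almostHermitian L),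
    cpart h (form_op (ah_omega h) (pq_p h))
      = cpart h (form_op (ah_g h) (pq_q h))
}.

Section Soliton.
Variables (R : realType) (pq : pqRule R).
Variables (L : lieAlgType R) (h : almostHermitian L).

Definition opP : 'End(L) := form_op (ah_omega h) (pq_p pq h).

Definition opQ : 'End(L) := form_op (ah_g h) (pq_q pq h).

Definition soliton_for (c : R) (D : 'End(L)) : Prop :=
  [/\ derivation D,
      opP = c *: \1%VF
            + 2^-1 *: (D - (ah_J h \o transpose h D \o ah_J h)%VF)
    & opQ = c *: \1%VF + 2^-1 *: (D + transpose h D)].

Definition is_soliton : Prop := exists c D, soliton_for c D.

End Soliton.

(* Main.v *)
(* Skew-symmetry of p = g(JP., .) says P^t = - J P J, and symmetry of q says
   Q^t = Q, so Q^ac is symmetric too.  Hence D = P + Q^ac - c I has transpose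
   - J P J + Q^ac - c I, and J Q^ac J = Q^ac gives D - J D^t J = 2 (P - c I).
   Moreover D + D^t = 2 (P^c + Q^ac - c I), where P^c = Q^c. *)
Require Import Defs.
From mathcomp Require Import all_boot all_order all_algebra.
From mathcomp Require Import sesquilinear reals.

Set Implicit Arguments.
Unset Strict Implicit.
Unset Printing Implicit Defensive.

Import Order.TTheory GRing.Theory Num.Theory.

Local Open Scope ring_scope.

Lemma scale_halfD (R : numFieldType) (V : lmodType R) (u : V) :
  2^-1 *: (u + u) = u.
Proof.
by rewrite -mulr2n -scaler_nat scalerA mulVf ?scale1r // pnatr_eq0.
Qed.

(** A vector in the radical is orthogonal to itself, so positivity forces it to vanish. This makes
    [form_opP] and [form_op_unique] available for [g]. *)
Lemma dot_nondegenerate (R : realType) (V : vectType R)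
    (g : {dot V for idfun}) :
  nondegenerate g.
Proof.
rewrite /nondegenerate -subv0; apply/subvP => x /mem_orthovP gx.
rewrite memv0; apply: contraT => /(@neq0_dnorm_gt0 _ _ _ g).
by rewrite gx ?memvf // ltxx.
Qed.

Section AlmostHermitianTheory.
Variables (R : realType) (V : vectType R) (h : almostHermitian V).
Implicit Types A B : 'End(V).
Local Notation g := (ah_g h).
Local Notation omega := (ah_omega h).
Local Notation J := (ah_J h).
Local Notation tr := (transpose h).

Lemma ah_gC x y : g x y = g y x.
Proof. by rewrite hermC /= expr0 mul1r. Qed.

Lemma skewC (w : {skew_symmetric V}) x y : w x y = - w y x.
Proof. by rewrite hermC /= expr1 mulN1r. Qed.

Lemma ah_JE x y : omega x y = g (J x) y.
Proof.
apply: (form_opP (@dot_nondegenerate _ _ g)); split=> [z|z] a u v /=.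
  exact: linearPl.
exact: linearPr.
Qed.

Lemma transposeE A x y : g (tr A x) y = g x (A y).
Proof.
symmetry; apply: (form_opP (@dot_nondegenerate _ _ g)
  (a := fun x y => g x (A y))).
split=> [z|z] a u v /=; first exact: linearPl.
by rewrite linearP; exact: linearPr.
Qed.

(** Nondegeneracy of [g] makes the adjoint relation determine the operator; each transpose below is
    found by checking that relation. *)
Lemma transpose_unique A B : (forall x y, g (B x) y = g x (A y)) -> tr A = B.
Proof.
move=> AB; apply: (form_op_unique (@dot_nondegenerate _ _ g)) => x y.
exact: etrans (transposeE A x y) (esym (AB x y)).
Qed.

Lemma transposeD A B : tr (A + B) = tr A + tr B.
Proof.
apply: transpose_unique => x y; rewrite !add_lfunE.
by rewrite linearDl linearDr /= !transposeE.
Qed.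

Lemma transposeZ k A : tr (k *: A) = k *: tr A.
Proof.
apply: transpose_unique => x y; rewrite !scale_lfunE.
by rewrite linearZl_LR linearZr_LR /= !transposeE.
Qed.

Lemma transpose1 : tr (\1%VF) = \1%VF.
Proof. by apply: transpose_unique => x y; rewrite !id_lfunE. Qed.

Lemma transpose_comp A B : tr (A \o B)%VF = (tr B \o tr A)%VF.
Proof. by apply: transpose_unique => x y; rewrite !comp_lfunE !transposeE. Qed.

Lemma ah_JK : (J \o J)%VF = - \1%VF. Proof. exact: ah_JJ. Qed.

Lemma ah_JKA A : (J \o (J \o A))%VF = - A.
Proof. by rewrite comp_lfunA ah_JK comp_lfunNl comp_lfun1l. Qed.

Lemma transposeJ : tr J = - J.
Proof.
apply: transpose_unique => x y.
by rewrite opp_lfunE linearNl /= -ah_JE (ah_gC x) -ah_JE (skewC _ y).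
Qed.

Lemma transpose_skew_op (p : {skew_symmetric V}) :
  tr (form_op omega p) = - (J \o form_op omega p \o J)%VF.
Proof.
have pE x y : p x y = omega (form_op omega p x) y.
  apply: (form_opP (ah_omega_nondegenerate h)).
  by split=> [z|z] a u v /=; [exact: linearPl | exact: linearPr].
apply: transpose_unique => x y.
(* The chain is - g(JPJx, y) = - p(Jx, y) = p(y, Jx) = omega(Py, Jx) = - omega(Jx, Py) = - g(JJx,
   Py), and [J^2 = -1] turns the last term into g(x, Py). *)
rewrite opp_lfunE !comp_lfunE linearNl /= -ah_JE -pE skewC opprK pE skewC ah_JE.
have -> : J (J x) = - x by rewrite -comp_lfunE ah_JK opp_lfunE id_lfunE.
by rewrite linearNl opprK.
Qed.

Lemma transpose_sym_op (q : {symmetric V}) : tr (form_op g q) = form_op g q.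
Proof.
have qE x y : q x y = g (form_op g q x) y.
  apply: (form_opP (@dot_nondegenerate _ _ g)).
  by split=> [z|z] a u v /=; [exact: linearPl | exact: linearPr].
apply: transpose_unique => x y.
by rewrite -qE ah_gC -qE hermC /= expr0 mul1r.
Qed.

Lemma cpart_acpart A : cpart h A + acpart h A = A.
Proof. by rewrite -scalerDr addrACA addNr addr0 scale_halfD. Qed.

(** Since J^t = - J, the two signs in (JAJ)^t = J^t A^t J^t cancel. *)
Lemma transpose_acpart A : tr (acpart h A) = acpart h (tr A).
Proof.
rewrite transposeZ transposeD !transpose_comp transposeJ.
by rewrite comp_lfunNl comp_lfunNr comp_lfunNr opprK comp_lfunA.
Qed.

(** The map A -> JAJ is an involution because [J^2 = -1] enters twice; it swaps the two summands of
    [acpart]. *)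
Lemma conjJ_acpart A : (J \o acpart h A \o J)%VF = acpart h A.
Proof.
rewrite -comp_lfunZr -comp_lfunZl comp_lfunDr comp_lfunDl.
by rewrite -!comp_lfunA ah_JKA ah_JK !comp_lfunNr comp_lfun1r opprK addrC
  comp_lfunA.
Qed.

Lemma conjJK A : (J \o (J \o A \o J) \o J)%VF = A.
Proof. by rewrite -!comp_lfunA ah_JKA ah_JK comp_lfunNr comp_lfun1r opprK. Qed.

End AlmostHermitianTheory.

Theorem proposition7p4 (R : realType) (pq : pqRule R) (n : nat)
    (L : lieAlgType R) (dimL : \dim {: L} = (2 * n)%N)
    (h : almostHermitian L) (c : R) (D : 'End(L)) (derD : derivation D)
    (hPQ : opP pq h + acpart h (opQ pq h) = c *: \1%VF + D) :
  is_soliton pq h /\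
  opP pq h = c *: \1%VF
             + 2^-1 *: (D - (ah_J h \o transpose h D \o ah_J h)%VF) /\
  opQ pq h = c *: \1%VF + 2^-1 *: (D + transpose h D).
Proof.
set J := ah_J h; set P := opP pq h in hPQ *; set Q := opQ pq h in hPQ *.
pose M := (J \o P \o J)%VF; pose E := acpart h Q.
pose K := c *: \1%VF : 'End(L).
have DE : D = P + E - K by rewrite hPQ addrC addKr.
have DtE : transpose h D = E - M - K.
  rewrite DE 2!transposeD transpose_skew_op transpose_acpart transpose_sym_op.
  rewrite /K -scaleNr transposeZ transpose1 scaleNr.
  by rewrite [- _ + _]addrC.
(* Conjugation fixes [E] and sends [M] back to [P], but JKJ = - K, which flips the sign of the
   scalar term. *)
have JDtJ : (J \o transpose h D \o J)%VF = E - P + K.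
  rewrite DtE !(comp_lfunDr, comp_lfunDl) !(comp_lfunNr, comp_lfunNl).
  rewrite conjJ_acpart conjJK -comp_lfunZr comp_lfun1r -comp_lfunZl ah_JK.
  by rewrite scalerN opprK.
have PE : P = K + 2^-1 *: (D - (J \o transpose h D \o J)%VF).
  rewrite JDtJ DE.
  have -> : P + E - K - (E - P + K) = (P - K) + (P - K).
    by rewrite [P + E - K]addrAC -[E - P + K]addrA [- P + K]addrC -[K - P]opprB
      -[LHS]addrA subKr.
  by rewrite scale_halfD addrC subrK.
have QE : Q = K + 2^-1 *: (D + transpose h D).
  rewrite DtE DE.
  (* Grouped so that halving yields the c-part (P - M)/2 of [P] and one copy of [E - K]. *)
  have -> : P + E - K + (E - M - K) = (P - M) + ((E - K) + (E - K)).
    by rewrite [E - M]addrC -![_ + E - K]addrA addrACA.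
  (* Here P^c is replaced by Q^c, which recombines with [E], the ac-part of [Q], to give [Q]. *)
  rewrite scalerDr scale_halfD -[2^-1 *: _]/(cpart h P) /P (pq_cpart pq h).
  by rewrite addrCA subrKC cpart_acpart.
by split; [exists c, D; split | split].
Qed.
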